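(* The following assertions about the trajectory set $\mathcal{S}$ are equivalent: (i) For every $f\in P$ with finite maturity and every node $(S,j)$, $\overline{I}_jf(S)=\overline{\sigma}_jf(S)$. (ii) Property $(L_{(S,j)})$ holds at every node $(S,j)$.
   Context: Trajectories and nodes. Fix $s_0\in\mathbb{R}$ and a trajectory set $\mathcal{S}$, i.e. a set of real sequences $S=(S_i)_{i\ge 0}$ with $S_0=s_0$. For $S\in\mathcal{S}$ and $j\ge 0$ let $\mathcal{S}_{(S,j)}=\{\tilde S\in\mathcal{S}:\tilde S_i=S_i,\ 0\le i\le j\}$; the pair $(S,j)$ (identified with $\mathcal{S}_{(S,j)}$) is called a node. Write $\Delta_iS=S_{i+1}-S_i$. Portfolios. $\mathcal{H}_{(S,j)}$ is the set of sequences $H=(H_i)_{i\ge j}$ of functions $H_i:\mathcal{S}_{(S,j)}\to\mathbb{R}$ such that $H_i(\tilde S)=H_i(\hat S)$ whenever $\tilde S_k=\hat S_k$ for $j\le k\le i$ (no measurability is required). For $V\in\mathbb{R}$, $H\in\mathcal{H}_{(S,j)}$, $n\ge j$, put $\Pi_{j,n}^{V,H}(\tilde S)=V+\sum_{i=j}^{n-1}H_i(\tilde S)\Delta_i\tilde S$ for $\tilde S\in\mathcal{S}_{(S,j)}$. $\mathcal{E}_{(S,j)}$ is the vector space of all functions $\Pi_{j,n}^{V,H}$ on $\mathcal{S}_{(S,j)}$ ($V\in\mathbb{R}$, $H\in\mathcal{H}_{(S,j)}$, $n$ an integer $\ge j$), and $\mathcal{E}_{(S,j)}^+$ is the set of its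 nonnegative elements. Operators. $Q$ is the set of all functions $\mathcal{S}\to[-\infty,\infty]$ and $P$ the set of all functions $\mathcal{S}\to[0,\infty]$. A function $f\in Q$ has finite maturity if there is $n\in\mathbb{N}$ such that $f(S)=f(\tilde S)$ for all $S\in\mathcal{S}$, $\tilde S\in\mathcal{S}_{(S,n)}$. Conventions: $0\cdot\infty=0$, $\infty+(-\infty)=\infty$, $u-v=u+(-v)$, $\inf\emptyset=\infty$. For $f\in P$, $\overline{I}_jf(S)$ is the infimum of all $\sum_{m\ge1}V^m$ for which there are $H^m\in\mathcal{H}_{(S,j)}$ with $\Pi_{j,n}^{V^m,H^m}\in\mathcal{E}^+_{(S,j)}$ for all $n\ge j$, $m\ge 1$, and $f\le\sum_{m\ge1}\liminf_{n\to\infty}\Pi_{j,n}^{V^m,H^m}$ on $\mathcal{S}_{(S,j)}$. For $f\in Q$, $\overline{\sigma}_jf(S)$ is the infimum of all $\sum_{m\ge0}V^m$ for which $f\le\sum_{m\ge0}f_m$ on $\mathcal{S}_{(S,j)}$, where $f_0=\Pi_{j,n_0}^{V^0,H^0}\in\mathcal{E}_{(S,j)}$ for some $n_0$ and, for $m\ge1$, $f_m=\liminf_{n\to\infty}\Pi_{j,n}^{V^m,H^m}$ with $\Pi_{j,n}^{V^m,H^m}\in\mathcal{E}^+_{(S,j)}$ for all $n\ge j$. Property $(L_{(S,j)})$: whenever $f=\Pi_{j,n_f}^{V,H}\in\mathcal{E}_{(S,j)}$ and $f_m=\liminf_{n\to\infty}\Pi_{j,n}^{V^m,H^m}$ with $\Pi_{j,n}^{V^m,H^m}\in\mathcal{E}^+_{(S,j)}$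 for all $n\ge j$, $m\ge1$, satisfy $f\le\sum_{m\ge1}f_m$ on $\mathcal{S}_{(S,j)}$, then $V\le\sum_{m\ge1}V^m$. *)

(* Defs.v *)
From HB Require Import structures.
From mathcomp Require Import all_boot all_order all_algebra.
From mathcomp Require Import all_classical all_reals all_analysis.

Set Implicit Arguments.
Unset Strict Implicit.
Unset Printing Implicit Defensive.

Import Order.TTheory GRing.Theory Num.Theory.
Import numFieldNormedType.Exports.

Local Open Scope classical_set_scope.
Local Open Scope ring_scope.

(* Functions on a trajectory set A (or on a node of A) are represented by total
   functions on sequences; every definition below only uses their values at
   the elements of A (resp. of the node). *)

Section Trajectories.
Context {R : realType}.
Implicit Types (A : set (nat -> R)) (S T : nat -> R) (i j n m : nat)
  (V : R) (H : nat -> (nat -> R) -> R) (f : (nat -> R) -> \bar R).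

Definition is_trajectory_set (s0 : R) A : Prop :=
  forall S, A S -> S 0%N = s0.

Definition node A S j : set (nat -> R) :=
  [set T | A T /\ forall i, (i <= j)%N -> T i = S i].

(* The components [H i] with [i < j] are never used. *)
Definition portfolio A S j : set (nat -> (nat -> R) -> R) :=
  [set H | forall i T U, (j <= i)%N -> node A S j T -> node A S j U ->
     (forall k, (j <= k <= i)%N -> T k = U k) -> H i T = H i U].

Definition wealth j n V H T : R :=
  V + \sum_(j <= i < n) H i T * (T i.+1 - T i).

Definition elementary A S j : set ((nat -> R) -> R) :=
  [set g | exists V H n, [/\ portfolio A S j H, (j <= n)%N &
     forall T, node A S j T -> g T = wealth j n V H T]].

Definition elementary_pos A S j : set ((nat -> R) -> R) :=
  [set g | elementary A S j g /\ forall T, node A S j T -> 0 <= g T].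

Definition liminf_wealth j V H T : \bar R :=
  limn_einf (fun n => (wealth j n V H T)%:E).

(* The term of index 0 of the two sequences is unconstrained. *)
Definition nonneg_portfolios A S j (Vs : nat -> R)
    (Hs : nat -> nat -> (nat -> R) -> R) : Prop :=
  forall m, (1 <= m)%N -> portfolio A S j (Hs m) /\
    forall n, (j <= n)%N -> elementary_pos A S j (wealth j n (Vs m) (Hs m)).

Definition finite_maturity A f : Prop :=
  exists n, forall S T, A S -> node A S n T -> f S = f T.

(* In the series below, the terms of index at least 1 are nonnegative: for
   [Vs m], take [n = j] in [nonneg_portfolios]. The term of index 0, when
   present, is finite. So each series converges in \bar R, and the sum of
   +oo and -oo never occurs. *)

Definition I_bar A j f S : \bar R :=
  ereal_inf [set c : \bar R | exists Vs Hs,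
    [/\ nonneg_portfolios A S j Vs Hs,
        forall T, node A S j T ->
          (f T <= \sum_(1 <= m <oo) liminf_wealth j (Vs m) (Hs m) T)%E &
        c = (\sum_(1 <= m <oo) (Vs m)%:E)%E]].

Definition sigma_bar A j f S : \bar R :=
  ereal_inf [set c : \bar R | exists Vs Hs n0,
    [/\ portfolio A S j (Hs 0%N), (j <= n0)%N, nonneg_portfolios A S j Vs Hs,
        forall T, node A S j T ->
          (f T <= \sum_(0 <= m <oo)
             (if m == 0%N then (wealth j n0 (Vs m) (Hs m) T)%:E
              else liminf_wealth j (Vs m) (Hs m) T))%E &
        c = (\sum_(0 <= m <oo) (Vs m)%:E)%E]].

Definition property_L A S j : Prop :=
  forall V H nf (Vs : nat -> R) (Hs : nat -> nat -> (nat -> R) -> R),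
    portfolio A S j H -> (j <= nf)%N -> nonneg_portfolios A S j Vs Hs ->
    (forall T, node A S j T ->
       ((wealth j nf V H T)%:E <=
          \sum_(1 <= m <oo) liminf_wealth j (Vs m) (Hs m) T)%E) ->
    (V%:E <= \sum_(1 <= m <oo) (Vs m)%:E)%E.

End Trajectories.

(* Main.v *)
Require Import Defs.
From HB Require Import structures.
From mathcomp Require Import all_boot all_order all_algebra.
From mathcomp Require Import all_classical all_reals all_analysis.
From mathcomp Require Import lra.

(** Write [I] for [I_bar] and [sigma] for [sigma_bar].

    If [I] and [sigma] agree on the function 0, then [sigma 0 = I 0 >= 0],
    since the initial values of nonnegative portfolios are nonnegative.
    Whenever [f <= sum f_m] with [f] elementary of initial value [V], the
    inequality [0 <= - f + sum f_m] makes [- V + sum V^m] a cost for [sigma 0],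
    so [V <= sum V^m]: this is property (L) ([property_L_of_le]).

    Conversely assume (L) everywhere.  A cost for [I] is always a cost for
    [sigma], so the point is to turn a superhedge [f <= f_0 + sum f_m], of
    finite total cost, into one by nonnegative portfolios of the same cost.
    Let [n] be beyond the maturities of [f] and [f_0].  Applying (L) at the
    node [(T, i)] with [j <= i <= n] shows that the total wealth at time [i],
    the sum over [m >= 0] of the time-[i] wealths, dominates every real lower
    bound of [f] on that node, as soon as this sum converges
    ([le_total_wealth]).  In particular it is nonnegative, and at time [n] it
    dominates [f].

    It remains to realise the total wealth by portfolios, that is to sum the
    positions [H^m_i].  At a node from which the trajectory may both rise and
    fall, nonnegativity of the portfolio [m] after either move bounds
    [|H^m_i|] by a multiple of its current wealth ([two_sided_bound]), so the
    positions are summable and [merged] holds their sum.  At any other node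
    the sum may diverge, but there trading is useless: holding 1 or -1
    according to the possible direction ([arbitrage]) never loses, and gains
    as soon as the price moves.  Countably many copies of this free strategy
    are worth +oo from the first such move on, so they pay for whatever
    follows, and [merged] stops trading then.  As long as no such move has
    occurred the value of [merged] equals the total wealth
    ([merged_wealth]).  So [merged], together with countably many
    copies of [arbitrage] of initial value 0, hedges [f] at the original
    cost ([hedge_dominates]). *)

Set Implicit Arguments.
Unset Strict Implicit.
Unset Printing Implicit Defensive.

Import Order.TTheory GRing.Theory Num.Theory.
Import numFieldNormedType.Exports.

(** * Limits inferior and series *)

Section Series.
Local Open Scope classical_set_scope.
Local Open Scope ring_scope.
Context {R : realType}.

Lemma le_limn_einf_eventually (u v : nat -> \bar R) N :
  (forall n, (N <= n)%N -> (u n <= v n)%E) -> (limn_einf u <= limn_einf v)%E.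
Proof.
move=> uv; rewrite !limn_einf_lim; apply: lee_lim; try exact: is_cvg_einfs.
near=> n; apply: le_ereal_inf_tmp => _ [m /= nm <-].
apply: ge_ereal_inf; exists (u m); first by exists m.
by apply: uv; apply: leq_trans nm; near: n; exists N.
Unshelve. all: by end_near. Qed.

Lemma eq_limn_einf_eventually (u v : nat -> \bar R) N :
  (forall n, (N <= n)%N -> u n = v n) -> limn_einf u = limn_einf v.
Proof.
move=> uv; apply/le_anti/andP; split;
  by apply: (@le_limn_einf_eventually _ _ N) => n Nn; rewrite uv.
Qed.

Lemma limn_einf_eventually_cst (u : nat -> \bar R) (l : \bar R) N :
  (forall n, (N <= n)%N -> u n = l) -> limn_einf u = l.
Proof.
move=> /eq_limn_einf_eventually ->.
by have [] := cvg_limn_einf_sup (@cvg_cst _ l _ \oo _).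
Qed.

(** The term of index 0 may be negative, so monotonicity of the partial sums is
    only available from index 1 on. *)
Lemma eseries_head (u : nat -> \bar R) :
  u 0%N \is a fin_num -> (forall m, (1 <= m)%N -> (0 <= u m)%E) ->
  (\sum_(0 <= m <oo) u m = u 0%N + \sum_(1 <= m <oo) u m)%E.
Proof.
move=> u0 uge0; apply/cvg_lim => //.
have c : (fun n => u 0%N + \sum_(1 <= m < n) u m)%E @ \oo -->
    (u 0%N + \sum_(1 <= m <oo) u m)%E.
  apply: cvgeD; [exact: fin_num_adde_defr|exact: cvg_cst|].
  by apply: is_cvg_nneseries => n n1 _; exact: uge0.
apply: cvg_trans c; apply: near_eq_cvg; near=> n.
by rewrite [RHS]big_ltn//; near: n; exists 1%N.
Unshelve. all: by end_near. Qed.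

Lemma eq_eseries_tail (u v : nat -> \bar R) :
  (forall m, (1 <= m)%N -> u m = v m) ->
  (\sum_(1 <= m <oo) u m = \sum_(1 <= m <oo) v m)%E.
Proof.
move=> uv; rewrite [LHS]eseries_cond [RHS]eseries_cond.
by apply: eq_eseriesr => m; exact: uv.
Qed.

Lemma cvg_series_EFin (a : nat -> R) (l : R) :
  series a @ \oo --> l -> (\sum_(0 <= m <oo) (a m)%:E = l%:E)%E.
Proof.
move=> al; apply/cvg_lim => //.
apply: cvg_EFin.
  by apply: nearW => n; rewrite sumEFin.
by apply: cvg_trans al; apply: near_eq_cvg; apply: nearW => n /=;
   rewrite sumEFin.
Qed.

Lemma is_cvg_series_lty (a : nat -> R) :
  (forall m, (1 <= m)%N -> 0 <= a m) ->
  (\sum_(0 <= m <oo) (a m)%:E < +oo)%E -> cvgn (series a).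
Proof.
move=> a0 aoo; have ea0 m : (1 <= m)%N -> (0 <= (a m)%:E)%E.
  by move=> /a0; rewrite lee_fin.
rewrite -(is_cvg_series_restrict 1); apply: nondecreasing_is_cvgn.
  by apply: nondecreasing_series => n n1 _; exact: a0.
have s0 : (0 <= \sum_(1 <= m <oo) (a m)%:E)%E.
  by apply: nneseries_ge0 => n n1 _; exact: ea0.
rewrite eseries_head// in aoo.
have sfin : (\sum_(1 <= m <oo) (a m)%:E)%E \is a fin_num.
  rewrite ge0_fin_numE// ltey; apply: contraTneq aoo => ->.
  by rewrite addey// ltxx.
exists (fine (\sum_(1 <= m <oo) (a m)%:E)%E) => _ [n _ <-].
rewrite -lee_fin fineK//= -sumEFin.
by apply: nneseries_lim_ge => m m1 _; exact: ea0.
Qed.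

Lemma is_cvg_series_dominated (a b : nat -> R) (C : R) :
  (forall m, (1 <= m)%N -> `|b m| <= C * a m) ->
  cvgn (series a) -> cvgn (series b).
Proof.
move=> ba ca; apply: normed_cvg.
pose v m := if m == 0%N then `|b 0%N| else C * a m.
have bv m : `|b m| <= v m by rewrite /v; case: m => [|m]//=; exact: ba.
apply: (@series_le_cvg _ _ v) .
- by move=> m; exact: normr_ge0.
- by move=> m; exact: le_trans (bv m).
- exact: bv.
rewrite -(is_cvg_series_restrict 1).
rewrite (_ : (fun n => _) = (fun n => \sum_(1 <= k < n) (C *: a) k)).
  by rewrite is_cvg_series_restrict; exact: is_cvg_seriesZ.
apply/funext => n; apply: eq_big_nat => k /andP[k1 _].
by rewrite /v; case: k k1.
Qed.

(** Infinitely many copies of a positive gain are worth +oo; the term of index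
    1 is left free because a hedge puts another portfolio there. *)
Lemma nneseries_cst_pinfty (u : nat -> \bar R) (g : R) : 0 < g ->
  (forall m, (1 <= m)%N -> (0 <= u m)%E) ->
  (forall m, (2 <= m)%N -> u m = g%:E) ->
  (\sum_(1 <= m <oo) u m = +oo)%E.
Proof.
move=> g0 u0 ug; apply/eqyP => A A0.
pose k := Num.bound (A / g).
have := @nneseries_lim_ge _ u xpredT 1%N k.+2 (fun n n1 _ => u0 n n1).
apply: le_trans; rewrite big_ltn//.
rewrite (eq_big_nat _ _ (F2 := fun=> g%:E)); last first.
  by move=> i /andP[i2 _]; exact: ug.
rewrite sumEFin sumr_const_nat subSS subn1/=.
apply: (@le_trans _ _ (g *+ k)%:E); last by rewrite leeDr// u0.
rewrite lee_fin -mulr_natr mulrC -ler_pdivrMr//.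
by apply: ltW; apply: archi_boundP; rewrite divr_ge0// ltW.
Qed.

End Series.

(** * Portfolios on a node and on its successors *)

Section Trading.
Local Open Scope classical_set_scope.
Local Open Scope ring_scope.
Context {R : realType}.
Variable A : set (nat -> R).
Implicit Types (S T U : nat -> R) (V : R) (H : nat -> (nat -> R) -> R).

Lemma wealth_start j V H T : wealth j j V H T = V.
Proof. by rewrite /wealth big_geq// addr0. Qed.

Lemma wealth_step j n V H T : (j <= n)%N ->
  wealth j n.+1 V H T = wealth j n V H T + H n T * (T n.+1 - T n).
Proof. by move=> jn; rewrite /wealth big_nat_recr//= addrA. Qed.

Lemma wealth_cat j i n V H T : (j <= i)%N -> (i <= n)%N ->
  wealth j n V H T = wealth i n (wealth j i V H T) H T.
Proof. by move=> ji jn; rewrite /wealth (big_cat_nat ji jn) addrA. Qed.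

(** Selling the portfolio out of an endowment [r]. *)
Lemma wealth_sub j n (r : R) V H T :
  wealth j n (r - V) (fun i U => - H i U) T = r - wealth j n V H T.
Proof.
rewrite /wealth opprD addrA -sumrN; congr (_ + _).
by apply: eq_bigr => i _; rewrite mulNr.
Qed.

Lemma wealth0 j n T : wealth j n 0 (fun=> fun=> 0) T = 0 :> R.
Proof. by rewrite /wealth big1 ?addr0// => i _; rewrite mul0r. Qed.

(** Liquidating at time [n] makes the wealth eventually constant, so that its
    limit inferior is the wealth at time [n]. *)
Definition stop n H : nat -> (nat -> R) -> R :=
  fun i T => if (i < n)%N then H i T else 0.

Lemma wealth_stop_le j n N V H T : (N <= n)%N ->
  wealth j N V (stop n H) T = wealth j N V H T.
Proof.
move=> Nn; congr (_ + _); apply: eq_big_nat => i /andP[_ iN].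
by rewrite /stop (leq_trans iN Nn).
Qed.

Lemma wealth_stop_ge j n N V H T : (j <= n)%N -> (n <= N)%N ->
  wealth j N V (stop n H) T = wealth j n V H T.
Proof.
move=> jn nN; rewrite (wealth_cat V (stop n H) T jn nN) (wealth_stop_le _ _ _ _ (leqnn n)).
rewrite {1}/wealth big_nat big1 ?addr0// => i /andP[ni _].
by rewrite /stop ltnNge ni mul0r.
Qed.

Lemma portfolio_opp S j H :
  portfolio A S j H -> portfolio A S j (fun i T => - H i T).
Proof. by move=> pH i T U ji nT nU TU; rewrite (pH i T U). Qed.

Lemma portfolio_stop S j n H :
  portfolio A S j H -> portfolio A S j (stop n H).
Proof.
by move=> pH i T U ji nT nU TU; rewrite /stop (pH i T U).
Qed.

Lemma node_refl T i : A T -> node A T i T.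
Proof. by []. Qed.

Lemma node_trans S T U j i : (j <= i)%N ->
  node A S j T -> node A T i U -> node A S j U.
Proof.
move=> ji [AT TS] [AU UT]; split=> // k kj.
by rewrite UT ?TS// (leq_trans kj).
Qed.

Lemma node_le T i k U : (k <= i)%N -> node A T i U -> node A T k U.
Proof. by move=> ki [AU UT]; split=> // l lk; rewrite UT// (leq_trans lk). Qed.

(** Trajectories of the node [(S, j)] already agree up to time [j], so agreement
    between [j] and [i] suffices. *)
Lemma node_eq S T U j i : node A S j T -> node A S j U ->
  (forall k, (j <= k <= i)%N -> T k = U k) -> node A T i = node A U i.
Proof.
move=> [AT TS] [AU US] TU.
have E k : (k <= i)%N -> T k = U k.
  move=> ki; have [kj|jk] := leqP k j; first by rewrite TS// US.
  by rewrite TU// (ltnW jk).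
by apply/seteqP; split=> W [AW WT]; split=> // k ki; rewrite WT// E.
Qed.

(** Restarting a portfolio at a later node loses no information: the
    trajectories of that node share the path between [j] and [i]. *)
Lemma portfolio_at S T j i H : (j <= i)%N -> node A S j T ->
  portfolio A S j H -> portfolio A T i H.
Proof.
move=> ji nT pH l U W il nU nW UW.
have nSU := node_trans ji nT nU; have nSW := node_trans ji nT nW.
apply: pH => //; first exact: leq_trans il.
move=> k /andP[jk kl]; have [ki|ik] := leqP k i.
  by case: nU => _ ->//; case: nW => _ ->.
by rewrite UW// (ltnW ik).
Qed.

Lemma portfolio_node S T U j i H : (j <= i)%N -> node A S j T ->
  portfolio A S j H -> node A T i U -> H i U = H i T.
Proof.
move=> ji nT pH nU; apply: pH => //; first exact: node_trans nU.
by move=> k /andP[_ ki]; case: nU => _ ->.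
Qed.

Lemma wealth_node S T U j i V H : node A S j T ->
  portfolio A S j H -> node A T i U -> wealth j i V H U = wealth j i V H T.
Proof.
move=> nT pH nU; congr (_ + _); apply: eq_big_nat => k /andP[jk ki].
have nkU := node_le (ltnW ki) nU.
by rewrite (portfolio_node jk nT pH nkU); case: nU => _ E; rewrite !E// ltnW.
Qed.

(** The wealth of a portfolio is elementary by construction, so
    only its sign matters. *)
Lemma nonneg_portfoliosP S j (Vs : nat -> R) Hs :
  nonneg_portfolios A S j Vs Hs <->
  forall m, (1 <= m)%N -> portfolio A S j (Hs m) /\
    forall n T, (j <= n)%N -> node A S j T ->
      0 <= wealth j n (Vs m) (Hs m) T.
Proof.
split=> nn m m1; have [pH H0] := nn m m1; split=> // n.
  by move=> T jn; have [_] := H0 n jn; apply.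
by move=> jn; split=> [|T nT]; [exists (Vs m), (Hs m), n|exact: H0].
Qed.

Lemma liminf_wealth_ge0 S j (Vs : nat -> R) Hs m T :
  nonneg_portfolios A S j Vs Hs -> (1 <= m)%N -> node A S j T ->
  (0 <= liminf_wealth j (Vs m) (Hs m) T)%E.
Proof.
move=> /nonneg_portfoliosP nn m1 nT; have [_ H0] := nn m m1.
rewrite -(@limn_einf_eventually_cst R (cst 0%E) 0%E 0)//.
by apply: (@le_limn_einf_eventually _ _ _ j) => n jn; rewrite lee_fin H0.
Qed.

Lemma initial_value_ge0 S j (Vs : nat -> R) Hs m :
  A S -> nonneg_portfolios A S j Vs Hs -> (1 <= m)%N -> 0 <= Vs m.
Proof.
move=> AS /nonneg_portfoliosP nn m1; have [_ H0] := nn m m1.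
by have := H0 j S (leqnn j) (node_refl j AS); rewrite wealth_start.
Qed.

Lemma nonneg_portfolios_at S T j i (Vs : nat -> R) Hs :
  (j <= i)%N -> node A S j T -> nonneg_portfolios A S j Vs Hs ->
  nonneg_portfolios A T i (fun m => wealth j i (Vs m) (Hs m) T) Hs.
Proof.
move=> ji nT /nonneg_portfoliosP nn; apply/nonneg_portfoliosP => m m1.
have [pH H0] := nn m m1; split; first exact: portfolio_at pH.
move=> n U i_n nU; rewrite -(wealth_node _ nT pH nU) -wealth_cat//.
by apply: H0; [exact: leq_trans i_n|exact: node_trans nU].
Qed.

Lemma liminf_wealth_at S T U j i V H : (j <= i)%N -> node A S j T ->
  portfolio A S j H -> node A T i U ->
  liminf_wealth i (wealth j i V H T) H U = liminf_wealth j V H U.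
Proof.
move=> ji nT pH nU; apply: (@eq_limn_einf_eventually _ _ _ i) => n i_n.
by rewrite -(wealth_node _ nT pH nU) -wealth_cat.
Qed.

(** * Two-sided nodes and free gains elsewhere *)

Definition two_sided T i :=
  (exists2 U, node A T i U & T i < U i.+1) /\
  (exists2 U, node A T i U & U i.+1 < T i).

(** At a node that is not two-sided, all moves are [>= 0] or all are [<= 0]; the
    position 1 or -1 then never loses.  If all moves are 0, the value -1
    is harmless. *)
Definition arbitrage i T : R :=
  if `[< two_sided T i >] then 0
  else if `[< exists2 U, node A T i U & T i < U i.+1 >] then 1 else -1.

Lemma arbitrage_two_sided T i : two_sided T i -> arbitrage i T = 0.
Proof. by move=> ?; rewrite /arbitrage asboolT. Qed.

(** [T] itself lies in its node, so its own next move has the admissible sign. *)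
Lemma arbitrage_gain T i : A T -> ~ two_sided T i ->
  arbitrage i T * (T i.+1 - T i) = `|T i.+1 - T i|.
Proof.
move=> AT n2; rewrite /arbitrage asboolF//.
case: asboolP => [up|nup].
  rewrite mul1r ger0_norm// subr_ge0 leNgt; apply/negP => dn.
  by apply: n2; split=> //; exists T.
rewrite mulN1r ler0_norm// subr_le0 leNgt; apply/negP => u.
by apply: nup; exists T.
Qed.

Lemma arbitrage_ge0 T i : A T -> 0 <= arbitrage i T * (T i.+1 - T i).
Proof.
move=> AT; have [t|t] := pselect (two_sided T i).
  by rewrite arbitrage_two_sided// mul0r.
by rewrite arbitrage_gain.
Qed.

Lemma two_sided_eq S T U j i : node A S j T -> node A S j U -> (j <= i)%N ->
  (forall k, (j <= k <= i)%N -> T k = U k) -> two_sided T i = two_sided U i.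
Proof.
move=> nT nU ji TU.
by rewrite /two_sided (node_eq nT nU TU) TU// ji leqnn.
Qed.

Lemma portfolio_arbitrage S j : portfolio A S j arbitrage.
Proof.
move=> i T U ji nT nU TU; rewrite /arbitrage (two_sided_eq nT nU ji TU).
by rewrite (node_eq nT nU TU) TU// ji leqnn.
Qed.

Lemma wealth_arbitrage_ge0 j n T : A T -> 0 <= wealth j n 0 arbitrage T.
Proof.
by move=> AT; rewrite /wealth add0r; apply: sumr_ge0 => i _; exact: arbitrage_ge0.
Qed.

(** If the price can rise by [u > 0] and fall by [d > 0], then nonnegativity
    after both moves gives [w + h u >= 0] and [w - h d >= 0] for the wealth [w]
    and the position [h], hence [|h| <= (1/u + 1/d) w].  The constant depends
    only on the node, so it serves all portfolios [H^m] at once. *)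
Lemma two_sided_bound S T j i : (j <= i)%N -> node A S j T -> two_sided T i ->
  exists C, forall V H, portfolio A S j H ->
    (forall U, node A S j U -> 0 <= wealth j i.+1 V H U) ->
    `|H i T| <= C * wealth j i V H T.
Proof.
move=> ji nT [[U nU TU] [D nD DT]].
pose u := U i.+1 - T i; pose d := T i - D i.+1.
have u0 : 0 < u by rewrite subr_gt0.
have d0 : 0 < d by rewrite subr_gt0.
exists (u^-1 + d^-1) => V H pH H0.
have := H0 U (node_trans ji nT nU); have := H0 D (node_trans ji nT nD).
rewrite !wealth_step// (wealth_node _ nT pH nU) (wealth_node _ nT pH nD).
rewrite (portfolio_node ji nT pH nU) (portfolio_node ji nT pH nD).
have -> : U i.+1 - U i = u by rewrite (nU.2 i).
have -> : D i.+1 - D i = - d by rewrite (nD.2 i)// opprB.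
set w := wealth _ _ _ _ _; set h := H i T => hd hu.
have hd' : h <= w / d by rewrite ler_pdivlMr//; lra.
have hu' : - h <= w / u by rewrite ler_pdivlMr//; lra.
rewrite [leRHS]mulrC mulrDr; clearbody w h u d.
have [h0|h0] := leP 0 h.
  have w0 : 0 <= w by have := mulr_ge0 h0 (ltW d0); lra.
  by rewrite ger0_norm//; have := divr_ge0 w0 (ltW u0); lra.
have w0 : 0 <= w.
  have : 0 <= - h * u by rewrite mulr_ge0// ?oppr_ge0 ltW.
  by lra.
by rewrite ltr0_norm//; have := divr_ge0 w0 (ltW d0); lra.
Qed.

(** * Merging a superhedge into nonnegative portfolios *)

Section Superhedge.
Variables (S : nat -> R) (j n : nat) (Vs : nat -> R).
Variable Hs : nat -> nat -> (nat -> R) -> R.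
Variable f : (nat -> R) -> \bar R.
Hypothesis L : forall T i, A T -> property_L A T i.
Hypothesis p0 : portfolio A S j (Hs 0).
Hypothesis jn : (j <= n)%N.
Hypothesis nn : nonneg_portfolios A S j Vs Hs.
Hypothesis f0 : forall T, A T -> (0 <= f T)%E.
Hypothesis fle : forall T, node A S j T ->
  (f T <= \sum_(0 <= m <oo)
     (if m == 0%N then (wealth j n (Vs m) (Hs m) T)%:E
      else liminf_wealth j (Vs m) (Hs m) T))%E.
Hypothesis cVs : cvgn (series Vs).

Let value i T := series (fun m => wealth j i (Vs m) (Hs m) T).

(** Property (L) at the node [(T, i)]: on that node the elementary function
    [r - f_0] is at most [sum f_m], and restarted at time [i] its initial value
    is [r] minus the time-[i] wealth of [f_0], while that of [f_m] is the
    time-[i] wealth of portfolio [m]. *)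
Lemma le_total_wealth T i (r l : R) : (j <= i <= n)%N -> node A S j T ->
  (forall U, node A T i U -> (r%:E <= f U)%E) ->
  value i T @ \oo --> l -> r <= l.
Proof.
move=> /andP[ji i_n] nT rf vl.
have AT : A T by case: nT.
have nni := nonneg_portfolios_at ji nT nn.
have /cvg_series_EFin := vl.
rewrite eseries_head//; last first.
  by move=> m m1; rewrite lee_fin; exact: initial_value_ge0 nni m1.
move=> sl.
have p0i := portfolio_at ji nT p0.
have := L AT (portfolio_opp p0i) i_n nni.
move=> /(_ (r - wealth j i (Vs 0%N) (Hs 0%N) T)) LT.
rewrite -lee_fin -sl -leeBlDl// -EFinB; apply: LT => U nU.
have nSU := node_trans ji nT nU.
have := le_trans (rf U nU) (fle nSU).
rewrite eseries_head//=; last first.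
  by move=> [|m]//= _; exact: liminf_wealth_ge0 nn _ nSU.
rewrite -leeBlDl//.
have E : (\sum_(1 <= m <oo)
   liminf_wealth i (wealth j i (Vs m) (Hs m) T) (Hs m) U =
   \sum_(1 <= m <oo) (if m == 0%N then (wealth j n (Vs m) (Hs m) U)%:E
      else liminf_wealth j (Vs m) (Hs m) U))%E.
  apply: eq_eseries_tail => -[|m]//= _.
  have [pm _] := (nonneg_portfoliosP _ _ _ _).1 nn m.+1 isT.
  exact: liminf_wealth_at nT pm nU.
rewrite -E; apply: le_trans; rewrite -EFinB lee_fin.
by rewrite wealth_sub -(wealth_node _ nT p0 nU) -wealth_cat.
Qed.

(** A positive wealth of [arbitrage] records that the price has moved at some
    node that was not two-sided; from then on trading stops. *)
Definition merged i T : R :=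
  if (wealth j i 0 arbitrage T == 0) && `[< two_sided T i >]
  then limn (series (fun m => Hs m i T)) else 0.

Lemma portfolio_merged : portfolio A S j merged.
Proof.
move=> i T U ji nT nU TU.
have nTU : node A T i U.
  by rewrite (node_eq nT nU TU); apply: node_refl; case: nU.
rewrite /merged (two_sided_eq nT nU ji TU).
rewrite (wealth_node _ nT (@portfolio_arbitrage S j) nTU).
congr (if _ then limn (series _) else _); apply/funext => -[|m].
  exact: p0.
have [pm _] := (nonneg_portfoliosP _ _ _ _).1 nn m.+1 isT.
exact: pm.
Qed.

(** By induction on [i]: at a two-sided node, convergence of the total wealth at
    time [i] makes the positions of time [i] summable, hence the total wealth
    at time [i.+1] converges, and its limit is nonnegative by property (L).
    Once trading has stopped, nonnegativity is inherited from the last value. *)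
Lemma merged_wealth i T : (j <= i <= n)%N -> node A S j T ->
  0 <= wealth j i (limn (series Vs)) merged T /\
  (wealth j i 0 arbitrage T = 0 ->
   value i T @ \oo --> wealth j i (limn (series Vs)) merged T).
Proof.
move=> /andP[ji i_n] nT; have AT : A T by case: nT.
have alive_ge0 k w : (j <= k <= n)%N -> value k T @ \oo --> w -> 0 <= w.
  by move=> jk; apply: (le_total_wealth (T := T)) => // U [AU _]; exact: f0.
have G0 k := wealth_arbitrage_ge0 j k AT.
set c := limn (series Vs).
have vj : value j T = series Vs.
  by rewrite /value; congr series; apply/funext => m; rewrite wealth_start.
have [k E] : exists k, i = (j + k)%N by exists (i - j)%N; rewrite subnKC.
rewrite {i ji}E in i_n *; elim: k i_n => [|k IH] i_n.
  have vc : value j T @ \oo --> wealth j j c merged T by rewrite vj wealth_start.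
  by rewrite addn0; split=> //; apply: alive_ge0 vc; rewrite leqnn.
rewrite addnS in i_n *; set i := (j + k)%N in IH i_n *.
have ji : (j <= i)%N by rewrite leq_addr.
have [IH0 IHc] := IH (ltnW i_n).
have gain := arbitrage_ge0 i AT.
(* Gains of [arbitrage] are never lost, so trading does not resume. *)
have [alive|dead] := eqVneq (wealth j i 0 arbitrage T) 0; last first.
  split; last first.
    rewrite wealth_step// => w0; move/eqP: dead; case.
    by have := G0 i; lra.
  by rewrite wealth_step// /merged (negbTE dead) mul0r addr0.
(* Outside two-sided nodes [merged] does not trade.  Either the price moves,
   and then [arbitrage] becomes positive, or it does not, and no wealth
   changes. *)
have [t|t] := pselect (two_sided T i); last first.
  have M : wealth j i.+1 c merged T = wealth j i c merged T.
    by rewrite wealth_step// /merged (asboolF t) andbF mul0r addr0.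
  rewrite M; split=> //.
  rewrite wealth_step// alive add0r arbitrage_gain// => /eqP.
  rewrite normr_eq0 => /eqP d0.
  rewrite /value; under eq_fun do rewrite wealth_step// d0 mulr0 addr0.
  exact: IHc.
have M : wealth j i.+1 c merged T = wealth j i c merged T +
    limn (series (fun m => Hs m i T)) * (T i.+1 - T i).
  by rewrite wealth_step// /merged alive eqxx (asboolT t).
have [C HC] := two_sided_bound ji nT t.
have cH : cvgn (series (fun m => Hs m i T)).
  apply: (@is_cvg_series_dominated _ (fun m => wealth j i (Vs m) (Hs m) T) _ C).
    move=> m m1; have [pm H0] := (nonneg_portfoliosP _ _ _ _).1 nn m m1.
    by apply: HC => // U nU; apply: H0 => //; exact: leqW.
  by apply/cvg_ex; eexists; exact: IHc.
have vc : value i.+1 T @ \oo --> wealth j i.+1 c merged T.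
  rewrite M.
  have -> : value i.+1 T = (fun N => value i T N +
     series (fun m => Hs m i T) N * (T i.+1 - T i)).
    apply/funext => N; rewrite /value /series/= mulr_suml -big_split/=.
    by apply: eq_bigr => m _; rewrite wealth_step.
  by apply: cvgD; [exact: IHc|exact: (cvgM cH (cvg_cst _))].
by split=> //; apply: alive_ge0 vc; rewrite leqW.
Qed.

(** The copies of [arbitrage] cost nothing, so the whole capital goes to
    [merged]; infinitely many of them are needed for one gain to be worth
    +oo. *)
Definition hedge_value m : R := if m == 1%N then limn (series Vs) else 0.

Definition hedge m : nat -> (nat -> R) -> R :=
  if m == 1%N then stop n merged else stop n arbitrage.

Lemma nonneg_hedge : nonneg_portfolios A S j hedge_value hedge.
Proof.
apply/nonneg_portfoliosP => m m1; rewrite /hedge_value /hedge.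
have [_|_] := eqVneq m 1%N.
  split=> [|N T jN nT]; first by apply: portfolio_stop; exact: portfolio_merged.
  have [Nn|/ltnW nN] := leqP N n.
    rewrite wealth_stop_le//.
    by have [] := @merged_wealth N T _ nT; rewrite ?jN.
  rewrite wealth_stop_ge//.
  by have [] := @merged_wealth n T _ nT; rewrite ?jn/=.
split=> [|N T jN [AT _]]; first by apply: portfolio_stop; exact: portfolio_arbitrage.
have [Nn|/ltnW nN] := leqP N n.
  by rewrite wealth_stop_le// wealth_arbitrage_ge0.
by rewrite wealth_stop_ge// wealth_arbitrage_ge0.
Qed.

Lemma hedge_cost : (\sum_(1 <= m <oo) (hedge_value m)%:E = (limn (series Vs))%:E)%E.
Proof.
apply: lim_near_cst => //; near=> N.
rewrite big_ltn; last by near: N; exists 2%N.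
rewrite big_nat big1 ?adde0// => -[|[|m]]//.
Unshelve. all: by end_near. Qed.

Lemma hedge_dominates T : node A S j T ->
  (forall U, node A T n U -> f T = f U) ->
  (f T <= \sum_(1 <= m <oo) liminf_wealth j (hedge_value m) (hedge m) T)%E.
Proof.
move=> nT fT; have AT : A T by case: nT.
have u0 m : (1 <= m)%N ->
    (0 <= liminf_wealth j (hedge_value m) (hedge m) T)%E.
  by move=> m1; exact: liminf_wealth_ge0 nonneg_hedge m1 nT.
have lim_stop V H : liminf_wealth j V (stop n H) T = (wealth j n V H T)%:E.
  by apply: (@limn_einf_eventually_cst _ _ _ n) => N nN; rewrite wealth_stop_ge.
have u1 : liminf_wealth j (hedge_value 1) (hedge 1) T =
    (wealth j n (limn (series Vs)) merged T)%:E by exact: lim_stop.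
have u2 m : (2 <= m)%N -> liminf_wealth j (hedge_value m) (hedge m) T =
    (wealth j n 0 arbitrage T)%:E.
  by case: m => [|[|m]]// _; exact: lim_stop.
have [g0|g0] := eqVneq (wealth j n 0 arbitrage T) 0; last first.
  rewrite (nneseries_cst_pinfty _ u0 u2) ?leey//.
  by rewrite lt_neqAle eq_sym g0 wealth_arbitrage_ge0.
have := @nneseries_lim_ge _ _ xpredT 1%N 2%N (fun m m1 _ => u0 m m1).
rewrite big_nat1 u1; apply: le_trans.
have [] := @merged_wealth n T _ nT; first by rewrite jn leqnn.
move=> _ /(_ g0) vl.
(* [f T] may a priori be +oo; bounding every real below it by the finite total
   wealth excludes this. *)
have le_real r : (r%:E <= f T)%E -> r <= wealth j n (limn (series Vs)) merged T.
  move=> rf; apply: (le_total_wealth (T := T) _ nT _ vl); first by rewrite jn leqnn.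
  by move=> U nU; rewrite -fT.
case: (f T) le_real => [r||] le_real; last by rewrite leNye.
  by rewrite lee_fin le_real.
by have := le_real (wealth j n (limn (series Vs)) merged T + 1) (leey _);
  rewrite gerDl ler10.
Qed.

End Superhedge.

(** * Comparison of the two operators *)

Lemma sigma_bar_le_I_bar f S j : A S ->
  (sigma_bar A j f S <= I_bar A j f S)%E.
Proof.
move=> AS; apply: le_ereal_inf_tmp => _ [Vs [Hs [nn fle ->]]].
apply: ereal_inf_lbound.
pose V' m := if m == 0%N then 0 else Vs m.
pose H' m := if m == 0%N then fun=> fun=> 0 else Hs m.
exists V', H', j.
have nn' : nonneg_portfolios A S j V' H' by case=> // m m1; exact: nn m.+1 m1.
split=> // [T nT|].
  rewrite eseries_head//=; last first.
    by move=> [|m]//= m1; exact: liminf_wealth_ge0 nn m1 nT.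
  rewrite /V' /H' /= wealth0 add0e; apply: le_trans (fle T nT) _.
  rewrite le_eqVlt; apply/orP; left; apply/eqP.
  by apply: eq_eseries_tail => -[].
rewrite [RHS]eseries_head//=; last first.
  by move=> [|m]// m1; rewrite lee_fin; exact: initial_value_ge0 AS nn m1.
by rewrite add0e; apply: eq_eseries_tail => -[].
Qed.

(** Selling [f] costs [- V], so a violation of (L) would superhedge 0 for
    [- V + sum V^m < 0], whereas [I_bar] of 0 is nonnegative. *)
Lemma property_L_of_le S j : A S ->
  (I_bar A j (fun=> 0%E) S <= sigma_bar A j (fun=> 0%E) S)%E ->
  property_L A S j.
Proof.
move=> AS Is V H n Vs Hs pH jn nn Hle.
pose V' m := if m == 0%N then - V else Vs m.
pose H' m := if m == 0%N then (fun i T => - H i T) else Hs m.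
have nn' : nonneg_portfolios A S j V' H' by case=> // m m1; exact: nn m.+1 m1.
have I0 : (0 <= I_bar A j (fun=> 0) S)%E.
  apply: le_ereal_inf_tmp => _ [Ws [Ks [nnW _ ->]]].
  apply: nneseries_ge0 => m m1 _; rewrite lee_fin.
  exact: initial_value_ge0 AS nnW m1.
have : (sigma_bar A j (fun=> 0) S <= \sum_(0 <= m <oo) (V' m)%:E)%E.
  apply: ereal_inf_lbound; exists V', H', n; split=> //.
    exact: portfolio_opp.
  move=> T nT; rewrite eseries_head//=; last first.
    by move=> [|m]//= _; exact: liminf_wealth_ge0 nn _ nT.
  rewrite /V' /H' /= -[- V]sub0r wealth_sub EFinB sub0e addeC sube_ge0//.
  apply: le_trans (Hle T nT) _; rewrite le_eqVlt; apply/orP; left; apply/eqP.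
  by apply: eq_eseries_tail => -[].
move=> /(le_trans Is)/(le_trans I0).
rewrite eseries_head//=; last first.
  by move=> [|m]// _; rewrite lee_fin (initial_value_ge0 AS nn).
rewrite EFinN addeC sube_ge0//.
by rewrite (eq_eseries_tail (v := fun m => (Vs m)%:E))// => -[].
Qed.

(** A cost [+oo] needs no hedge; a finite one makes the initial values summable,
    which starts the induction behind [merged_wealth]. *)
Lemma I_bar_le_sigma_bar f S j : A S ->
  (forall T i, A T -> property_L A T i) ->
  (forall T, A T -> (0 <= f T)%E) -> finite_maturity A f ->
  (I_bar A j f S <= sigma_bar A j f S)%E.
Proof.
move=> AS L f0 [nf fnf]; apply: le_ereal_inf_tmp => _ [Vs [Hs [n0 [p0 jn0 nn fle ->]]]].
(* [f_0] and [f] must be settled at a common time; [f_0] is frozen at [n0]. *)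
pose n := maxn n0 nf.
have jn : (j <= n)%N by rewrite (leq_trans jn0)// leq_maxl.
pose Ks m := if m == 0%N then stop n0 (Hs 0%N) else Hs m.
have pK : portfolio A S j (Ks 0%N) by apply: portfolio_stop.
have nnK : nonneg_portfolios A S j Vs Ks by case=> // m m1; exact: nn m.+1 m1.
have fleK T : node A S j T -> (f T <= \sum_(0 <= m <oo)
     (if m == 0%N then (wealth j n (Vs m) (Ks m) T)%:E
      else liminf_wealth j (Vs m) (Ks m) T))%E.
  move=> nT; apply: le_trans (fle T nT) _; rewrite le_eqVlt; apply/orP; left; apply/eqP.
  apply: eq_eseriesr => -[|m]//= _.
  by rewrite wealth_stop_ge// leq_maxl.
have V0 m : (1 <= m)%N -> 0 <= Vs m by exact: initial_value_ge0 AS nn.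
have [->|] := eqVneq (\sum_(0 <= m <oo) (Vs m)%:E)%E +oo%E; first by rewrite leey.
rewrite -ltey => /(is_cvg_series_lty V0) cVs.
have -> := cvg_series_EFin cVs; rewrite -hedge_cost.
apply: ereal_inf_lbound; exists (hedge_value Vs), (hedge j n Ks).
split=> //; first exact: (nonneg_hedge L pK jn nnK f0 fleK cVs).
move=> T nT; apply: (hedge_dominates L pK jn nnK f0 fleK cVs nT).
move=> U nU; apply: fnf; first by case: nT.
by apply: node_le nU; exact: leq_maxr.
Qed.

End Trading.

Theorem theorem6p4 (R : realType) (s0 : R) (A : set (nat -> R))
    (hA : is_trajectory_set s0 A) :
  (forall f : (nat -> R) -> \bar R,
     (forall S, A S -> (0 <= f S)%E) -> finite_maturity A f ->
     forall (S : nat -> R) (j : nat), A S -> I_bar A j f S = sigma_bar A j f S)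
  <->
  (forall (S : nat -> R) (j : nat), A S -> property_L A S j).
Proof.
split=> [Isigma S j AS|L f f0 fm S j AS].
  by apply: property_L_of_le => //; rewrite Isigma//; exists 0%N.
apply/le_anti/andP; split; last exact: sigma_bar_le_I_bar.
exact: I_bar_le_sigma_bar.
Qed.
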